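(* Let $G$ be a finitely generated sofic group, let $M\subset G$ be a finite subset, let $A$ be a finite alphabet (a finite set), and let $S=A^{A^M}$. Suppose that $s\in S^G$ is asymptotically constant and that $\sigma_s\colon A^G\to A^G$ is stably injective. Then $\sigma_s$ is stably invertible.
   Context: Sofic group (standard notion): $G$ is sofic if for every finite $K\subset G$ and every $\varepsilon>0$ there exist $n\ge 1$ and a map $\varphi\colon G\to \mathrm{Sym}(n)$ with $d_H(\varphi(gh),\varphi(g)\varphi(h))\le\varepsilon$ for all $g,h\in K$ and $d_H(\varphi(g),\varphi(h))\ge 1-\varepsilon$ for all distinct $g,h\in K$, where $d_H$ is the normalized Hamming distance. For a set $B$, $B^G$ is the set of maps (configurations) $G\to B$, with the prodiscrete topology (product of discrete topologies) and the shift action $(gx)(h)=x(g^{-1}h)$ for $g,h\in G$, $x\in B^G$. For $x\in B^G$, $\Sigma(x)=\overline{\{gx: g\in G\}}\subset B^G$. Two configurations $x,y\in B^G$ are asymptotic if $x|_{G\setminus E}=y|_{G\setminus E}$ for some finite $E\subset G$; a configuration is asymptotically constant if it is asymptotic to a constant configuration. $S=A^{A^M}$ is the set of all maps $A^M\to A$. For $s\in S^G$, the non-uniform cellular automaton (NUCA) $\sigma_s\colon A^G\to A^G$ is defined by $\sigma_s(x)(g)=s(g)\big((g^{-1}x)|_M\big)$ for $x\in A^G$, $g\in G$. $\sigma_s$ is stably injective if $\sigma_p$ is injective for every $p\in\Sigma(s)\subset S^G$. $\sigma_s$ is stably invertible if there exist a finite set $N\subset G$ and $t\in T^G$, where $T=A^{A^N}$,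 such that for every $p\in\Sigma(s)$ there is some $q\in\Sigma(t)$ with $\sigma_p\circ\sigma_q=\sigma_q\circ\sigma_p=\mathrm{Id}$. *)

(* Defs.v *)
From HB Require Import structures.
From mathcomp Require Import all_boot all_order all_algebra all_fingroup.
From mathcomp Require Import finmap.
From mathcomp Require Import boolp classical_sets reals topology.

Set Implicit Arguments.
Unset Strict Implicit.
Unset Printing Implicit Defensive.

Import Order.TTheory GRing.Theory Num.Theory.
Local Open Scope classical_set_scope.
Local Open Scope ring_scope.

(* A [groupType] is an arbitrary, possibly infinite, group. *)

Definition finitely_generated (G : groupType) : Prop :=
  exists X : {fset G},
    smallest [set H : set G | group_closed (fun g : G => g \in H)] [set` X] =
    [set: G].

Definition hamming (R : realType) (n : nat) (u v : {perm 'I_n}) : R :=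
  #|[pred i | u i != v i]|%:R / n%:R.

(* In [{perm 'I_n}], [(u * v)%g i = v (u i)]; hence the usual composite
   [phi g \o phi h] is [(phi h * phi g)%g]. *)
Definition sofic (R : realType) (G : groupType) : Prop :=
  forall (K : {fset G}) (e : R), 0 < e ->
  exists n : nat, (0 < n)%N /\
  exists phi : G -> {perm 'I_n},
    (forall g h, g \in K -> h \in K ->
       hamming R (phi (g * h)%g) (phi h * phi g)%g <= e) /\
    (forall g h, g \in K -> h \in K -> g <> h ->
       1 - e <= hamming R (phi g) (phi h)).

Definition config (G : groupType) (B : choiceType) : Type :=
  {ptws G -> discrete_topology B}.

HB.instance Definition _ (G : groupType) (B : choiceType) :=
  Topological.on (config G B).

Definition shift (G : groupType) (B : choiceType) (g : G) (x : config G B) :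
    config G B :=
  fun h => x (g^-1 * h)%g.

Definition orbit_closure (G : groupType) (B : choiceType) (x : config G B) :
    set (config G B) :=
  closure [set shift g x | g in [set: G]].

Definition asymptotic (G : groupType) (B : choiceType) (x y : config G B) :
    Prop :=
  exists E : {fset G}, forall g, g \notin E -> x g = y g.

Definition asymptotically_constant (G : groupType) (B : choiceType)
    (x : config G B) : Prop :=
  exists b : B, asymptotic x (fun=> b).

Definition local_map (G : groupType) (A : finType) (M : {fset G}) : finType :=
  {ffun {ffun M -> A} -> A}.

Definition restrict (G : groupType) (A : finType) (M : {fset G})
    (x : config G A) : {ffun M -> A} :=
  [ffun m : M => x (val m)].

Definition nuca (G : groupType) (A : finType) (M : {fset G})
    (s : config G (local_map A M)) (x : config G A) : config G A :=
  fun g => (s g : {ffun {ffun M -> A} -> A}) (restrict M (shift g^-1%g x)).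

Definition stably_injective (G : groupType) (A : finType) (M : {fset G})
    (s : config G (local_map A M)) : Prop :=
  forall p, orbit_closure s p -> injective (nuca p).

Definition stably_invertible (G : groupType) (A : finType) (M : {fset G})
    (s : config G (local_map A M)) : Prop :=
  exists (N : {fset G}) (t : config G (local_map A N)),
    forall p, orbit_closure s p ->
    exists q, orbit_closure t q /\
      nuca p \o nuca q = id /\ nuca q \o nuca p = id.

(* Main.v *)
Require Import Defs.
From mathcomp Require Import all_boot all_order all_algebra all_fingroup finmap.
From mathcomp Require Import boolp classical_sets cardinality reals topology.
From mathcomp Require Import fintype finset finmap zify.

(** Let [s] equal the constant [c] off the finite set [E].

    When [G] is infinite, the orbit of [s] accumulates at the constant
    configuration [c], so stable injectivity makes both [nuca s] and the
    cellular automaton [nuca (fun=> c)] injective.  By compactness an injective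
    NUCA can be decoded locally: [x g] is a function of finitely many letters
    of the image of [x] ([nuca_decoder]).  For the constant rule the decoder is
    the same at every point, so [nuca (fun=> c)] has a left inverse
    [nuca (fun=> d)] which is a cellular automaton.

    Soficity enters only to make this inverse two-sided
    ([sofic_ca_directly_finite]); this is the counting argument of Gromov and
    Weiss.  If [nuca (fun=> c) \o nuca (fun=> d)] moves some [y], then the
    pattern of [y] on a finite window never occurs in an image of
    [nuca (fun=> c)].  On a sofic model, a set of [n] points on which [G]
    almost acts, the rule [c] induces a self-map of [A ^ n].  Its image misses
    the pattern around a positive proportion of points, hence is exponentially
    smaller than [A ^ n], whereas the decoder [d] forces the map to be nearly
    injective.

    Passing from [c] to [s] needs no further counting.  The composite
    [tau = nuca (fun=> d) \o nuca s] is injective and fixes all letters off a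
    finite set [F].  Given the letters off [F], it permutes the finitely many
    fillings of [F], so it is onto ([finite_perturbation_surj]); hence
    [nuca s] is onto as well.  Its inverse is the NUCA which uses [d] off [F]
    and the local decoders of [nuca s] on [F].  The orbit closure of [s]
    consists of the translates of [s], which are inverted by the same
    translates of this field of rules, and of [c], which is inverted by [d].

    When [G] is finite, [F = G] does the same work, and the orbit closure is
    the orbit. *)

Set Implicit Arguments.
Unset Strict Implicit.
Unset Printing Implicit Defensive.

Import Order.TTheory GRing.Theory Num.Theory.
Local Open Scope fset_scope.

(** * Topology and compactness of configuration spaces *)

Lemma nbhs_config_window (G : groupType) (B : choiceType) (p : config G B)
    (K : {fset G}) :
  nbhs p [set x : config G B | forall h, h \in K -> x h = p h]%classic.
Proof.
have eval h : nbhs p [set x : config G B | x h = p h]%classic.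
  have := @proj_continuous G (fun _ => discrete_topology B) h p.
  by move=> /(_ _ (@discrete_set1 (discrete_topology B) (p h))).
have: nbhs p
    [set x : config G B | forall h, h \in enum_fset K -> x h = p h]%classic.
  elim: (enum_fset K) => [|h l IH]; first by apply: filterE.
  near=> x => k; rewrite inE => /predU1P[->|].
    by near: x; exact: eval.
  by move: k; near: x.
by [].
Unshelve. all: by end_near. Qed.

(** The filter generated by the windows around [p] converges to [p] coordinate
    by coordinate, hence in the product topology. *)
Lemma nbhs_config_sub_window (G : groupType) (B : choiceType) (p : config G B)
    (U : set (config G B)) :
  nbhs p U ->
  exists K : {fset G}, forall x, (forall h, h \in K -> x h = p h) -> U x.
Proof.
pose win (K : {fset G}) :=
  [set x : config G B | forall h, h \in K -> x h = p h]%classic.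
pose F := filter_from [set: {fset G}]%classic win.
have FF : Filter F.
  apply: filter_from_filter; first by exists fset0.
  move=> K L _ _; exists (K `|` L) => // x Hx.
  by split=> h hK; apply: Hx; rewrite inE hK ?orbT.
suff: cvg_to F (nbhs p) by move=> cv /cv [K _ KU]; exists K => x; exact: KU.
apply/(@cvg_sup _ _ _ _ p) => h; apply/cvg_image.
  by apply/seteqP; split=> // b _; exists (fun=> b).
move=> W Wp; exists (fun x : config G B => W (x h)).
  exists [fset h] => // x /= ->; last by rewrite inE.
  exact: (nbhs_singleton Wp).
by apply/seteqP; split=> [b [x Wx <-]//|b Wb]; exists (fun=> b).
Qed.

Lemma closure_configP (G : groupType) (B : choiceType)
    (S : set (config G B)) (p : config G B) :
  closure S p <->
  forall K : {fset G}, exists2 x, S x & forall h, h \in K -> x h = p h.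
Proof.
split=> [clSp K|win U /nbhs_config_sub_window[K KU]].
  by have [x [Sx xK]] := clSp _ (nbhs_config_window p K); exists x.
by have [x Sx xK] := win K; exists x; split=> //; exact: KU.
Qed.

(** Compactness of [config G B], for nets indexed by the finite subsets of [G]:
    arbitrarily far along the net, some [z W] is as close to the cluster point
    as required. *)
Lemma config_cluster_point (G : groupType) (B : finType)
    (z : {fset G} -> config G B) :
  exists x : config G B, forall K W0 : {fset G}, exists2 W : {fset G},
    W0 `<=` W & forall h, h \in K -> z W h = x h.
Proof.
pose F := filter_from [set: {fset G}]%classic
   (fun W0 => [set z W | W in [set W : {fset G} | (W0 `<=` W)%fset]]%classic).
have FF : ProperFilter F.
  apply: filter_from_proper.
    apply: filter_from_filter; first by exists fset0.
    move=> K L _ _; exists (K `|` L) => // _ [W /= sub <-].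
    split; exists W => //=; apply: fsubset_trans sub.
      exact: fsubsetUl.
    exact: fsubsetUr.
  by move=> W0 _; exists (z W0), W0 => /=.
have /(_ F FF) [|x [_ clx]] := @tychonoff G (fun=> discrete_topology B)
    (fun=> [set: _]%classic) (fun=> @finite_compact (discrete_topology B) _
    (@finite_finset B [set: _]%classic)).
  by exists fset0.
exists x => K W0.
have [|_ [[W sub <-] zW]] := clx
    [set z W | W in [set W : {fset G} | (W0 `<=` W)%fset]]%classic _ _
    (nbhs_config_window x K).
  by exists W0.
by exists W.
Qed.

(** * Counting words that avoid a pattern *)

Lemma bernoulli_nat r n : r ^ n * (r + n).+1 <= r.+1 ^ n.+1.
Proof.
elim: n => [|n IH]; first by rewrite expn0 mul1n addn0 expn1.
rewrite [X in _ <= X]expnS; apply: leq_trans (leq_mul (leqnn _) IH).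
by rewrite expnS; nia.
Qed.

(** [(r / r.+1) ^ L] drops below [1 / a] once [L] exceeds [a * r]: this many
    independent constraints, each removing one of [r.+1] words, cost more than
    one free letter out of [a]. *)
Lemma entropy_gap a r : 0 < a -> a * r ^ (a * r).+1 < r.+1 ^ (a * r).+1.
Proof.
move=> a0; apply: leq_trans (bernoulli_nat r (a * r)).
rewrite expnS mulnCA mulnA mulnC.
have : 0 < r ^ (a * r) by case: r => [|r]; rewrite ?muln0 ?expn0 ?expn_gt0.
nia.
Qed.

(** In a maximal [P], every [j] in [V] collides with some [i] in [P], that is,
    [e d j = e d' i] for some [d] and [d']; the triple [(i, d, d')] recovers [j]
    because [e d] is a permutation. *)
Lemma disjoint_packing (T D : finType) (e : D -> {perm T}) (V : {set T}) :
  0 < #|D| ->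
  exists2 P : {set T}, P \subset V &
    (forall i j d d', i \in P -> j \in P -> e d i = e d' j -> i = j) /\
    #|V| <= #|P| * #|D| ^ 2.
Proof.
move=> /card_gt0P[d0 _].
pose ok (P : {set T}) := (P \subset V) &&
  [forall i in P, forall j in P, forall d, forall d',
     (e d i == e d' j) ==> (i == j)].
have okP (P : {set T}) : reflect (P \subset V /\ forall i j d d',
    i \in P -> j \in P -> e d i = e d' j -> i = j) (ok P).
  apply: (iffP andP) => -[PV H]; split=> //.
    move=> i j d d' iP jP /eqP eij.
    move/forall_inP: H => /(_ i iP) /forall_inP /(_ j jP).
    by move=> /forallP /(_ d) /forallP /(_ d') /implyP /(_ eij) /eqP.
  apply/forall_inP => i iP; apply/forall_inP => j jP.
  apply/forallP => d; apply/forallP => d'.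
  by apply/implyP => /eqP /H -> //.
have ok0 : ok set0.
  by apply/okP; split=> [|i j d d']; rewrite ?sub0set ?inE.
have [P /maxsetP[/okP[PV disj] maxP] _] := maxset_exists ok0.
exists P => //; split=> //.
suff VS : V \subset
    [set (e u.2.1)^-1%g (e u.2.2 u.1) | u in setX P [set: D * D]].
  apply: leq_trans (subset_leq_card VS) _.
  apply: leq_trans (leq_imset_card _ _) _.
  by rewrite cardsX cardsT card_prod -mulnn.
apply/subsetP => j jV.
have [jP|jP] := boolP (j \in P).
  by apply/imsetP; exists (j, (d0, d0)); rewrite ?inE ?andbT //= permK.
apply/negPn/negP => jnot.
have sep i d d' : i \in P -> e d j <> e d' i.
  move=> iP edj; move/imsetP: jnot; apply.
  by exists (i, (d, d')); rewrite ?inE ?andbT //= -edj permK.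
suff : j |: P = P by move=> jPP; move: jP; rewrite -jPP setU11.
apply: maxP; last exact: subsetUr.
apply/okP; split; first by rewrite subUset sub1set jV.
move=> i k d d' /setU1P[->|iP] /setU1P[->|kP] // eik; last exact: disj eik.
- by case: (sep _ _ _ kP eik).
- by case: (sep _ _ _ iP (esym eik)).
Qed.

(** The sites [e d i] of distinct [i] in [P] are disjoint, so avoiding [w] at
    each [i] are independent constraints, each of density
    [(#|A| ^ #|D|).-1 / #|A| ^ #|D|].  They are imposed one [i] at a time. *)
Lemma card_avoiding (T D A : finType) (e : D -> {perm T}) (w : D -> A)
    (P : {set T}) :
  (forall i, i \in P -> injective (e^~ i)) ->
  (forall i j d d', i \in P -> j \in P -> e d i = e d' j -> i = j) ->
  #|[set y : {ffun T -> A} |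
      [forall i in P, ~~ [forall d, y (e d i) == w d]]]| *
    (#|A| ^ #|D|) ^ #|P|
  <= (#|A| ^ #|D|).-1 ^ #|P| * #|A| ^ #|T|.
Proof.
move cP : #|P| => n; elim: n P cP => [|n IH] P cP injP disjP.
  rewrite !expn0 muln1 mul1n.
  by apply: leq_trans (max_card _) _; rewrite card_ffun.
have /card_gt0P[i iP] : 0 < #|P| by rewrite cP.
set Y := finset _; set q := #|A| ^ #|D| in IH *.
pose Y' := [set y : {ffun T -> A} |
  [forall j in P :\ i, ~~ [forall d, y (e d j) == w d]]].
pose B := [set y in Y' | [forall d, y (e d i) == w d]].
have IHn : #|Y'| * q ^ n <= q.-1 ^ n * #|A| ^ #|T|.
  apply: IH; first by have := cardsD1 i P; rewrite iP cP add1n => -[].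
    by move=> j /setD1P[_ jP]; apply: injP.
  by move=> j k d d' /setD1P[_ jP] /setD1P[_ kP]; apply: disjP.
have cY : (#|Y| + #|B| = #|Y'|)%N.
  rewrite -(cardsID B Y') addnC.
  congr (_ + _)%N; apply: eq_card => y; rewrite !inE.
    by rewrite andbA andbb.
  rewrite negb_and andb_orl andNb /=.
  apply/forall_inP/andP => [H|[H /forall_inP HP] j jP].
    by split; [apply: H|apply/forall_inP => j /setD1P[_ jP]; apply: H].
  by have [->//|ji] := eqVneq j i; apply: HP; rewrite !inE ji.
(* [md] writes the pattern [w] around [i]; since this leaves the sites of the
   other points of [P] untouched, a word of [Y'] is determined by its
   modification, which lies in [B], and by its old letters around [i]. *)
pose md (y : {ffun T -> A}) :=
  [ffun t => if [pick d | e d i == t] is Some d then w d else y t].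
have mdi y d : md y (e d i) = w d.
  rewrite ffunE; case: pickP => [d' /eqP|/(_ d)]; last by rewrite eqxx.
  by move=> /(injP _ iP) ->.
have mdn y t : (forall d, e d i != t) -> md y t = y t.
  by move=> nt; rewrite ffunE; case: pickP => // d; rewrite (negbTE (nt d)).
have leY' : #|Y'| <= #|B| * q.
  have -> : q = #|[set: {ffun D -> A}]| by rewrite cardsT card_ffun.
  rewrite -cardsX.
  pose split_at (y : {ffun T -> A}) := (md y, [ffun d => y (e d i)]).
  rewrite -(@card_in_imset _ _ split_at Y').
    apply/subset_leq_card/subsetP => _ /imsetP[y yY' ->]; rewrite !inE /= andbT.
    apply/andP; split; last by apply/forallP => d; rewrite mdi.
    move: yY'; rewrite inE => /forall_inP yY'.
    apply/forall_inP => j /[dup] /setD1P[ji jP] /yY'.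
    congr (~~ _); apply: eq_forallb => d; rewrite mdn // => d'.
    by apply: contra ji => /eqP ed; rewrite (disjP _ _ _ _ iP jP ed).
  move=> y z _ _ [emd er]; apply/ffunP => t.
  have [/existsP[d /eqP <-]|/existsPn nt] := boolP [exists d, e d i == t].
    by move/ffunP: er => /(_ d); rewrite !ffunE.
  by rewrite -(mdn y) // -(mdn z) // emd.
have step : #|Y| * q <= q.-1 * #|Y'| by nia.
by rewrite [q ^ _]expnS [q.-1 ^ _]expnS; nia.
Qed.

(** A word is recovered from its image under [f] and its letters on [X]. *)
Lemma card_range_partial_inverse (T A : finType)
    (f : {ffun T -> A} -> {ffun T -> A})
    (X : {set T}) (Y : {set {ffun T -> A}}) :
  (forall x, f x \in Y) ->
  (forall x y, f x = f y -> forall i, i \notin X -> x i = y i) ->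
  #|A| ^ #|T| <= #|Y| * #|A| ^ #|X|.
Proof.
move=> fY finj.
pose g x := (f x, [ffun i : {i | i \in X} => x (val i)]).
rewrite -card_ffun -(card_sig (mem X)) -card_ffun.
rewrite -[#|{ffun {x | _} -> _}|]cardsT -cardsX -cardsT.
rewrite -(@card_imset _ _ g).
  by apply/subset_leq_card/subsetP => _ /imsetP[x _ ->]; rewrite !inE fY.
move=> x y [efx er]; apply/ffunP => i.
have [iX|iX] := boolP (i \in X); last exact: finj efx i iX.
by move/ffunP: er => /(_ (exist _ i iX)); rewrite !ffunE.
Qed.

(** With [k] sites around each point, disjoint families of sites are found
    around one point in [k ^ 2]; by [entropy_gap], [(a * (a ^ k).-1).+1] such
    families outweigh one exceptional point. *)
Definition defect_constant (a k : nat) : nat :=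
  ((a * (a ^ k).-1).+1 * k ^ 2).+1.

(** The counting argument.  Off the exceptional set [X], the map [f] loses no
    information and yet its values never show the pattern [w].  A maximal
    disjoint packing of sites makes the image too small for this, unless [X]
    has a definite proportion of all points. *)
Lemma defect_lower_bound (T D A : finType) (e : D -> {perm T}) (w : D -> A)
    (f : {ffun T -> A} -> {ffun T -> A}) (X : {set T}) :
  0 < #|T| -> 0 < #|D| ->
  (forall i, i \notin X -> injective (e^~ i)) ->
  (forall x y, f x = f y -> forall i, i \notin X -> x i = y i) ->
  (forall x i, i \notin X -> exists d, f x (e d i) <> w d) ->
  #|T| < #|X| * defect_constant #|A| #|D|.
Proof.
move=> T0 D0 injX finj avoid.
have A0 : 0 < #|A|.
  by case/card_gt0P: D0 => d _; apply/card_gt0P; exists (w d).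
rewrite ltnNge; apply/negP => leXT.
have [P PX [disj cP]] := disjoint_packing e (~: X) D0.
have PnX i : i \in P -> i \notin X by move=> /(subsetP PX); rewrite inE.
have := card_avoiding w (fun i iP => injX i (PnX i iP)) disj.
set Y := finset _ => cY.
have fY x : f x \in Y.
  rewrite inE; apply/forall_inP => i /PnX /(avoid x)[d nd].
  by apply/forallPn; exists d; apply/eqP.
have cT := card_range_partial_inverse fY finj.
set a := #|A| in cY cT leXT A0 *.
move: leXT; rewrite /defect_constant.
set L := (a * _).+1 => leXT.
have q0 : 0 < a ^ #|D| by rewrite expn_gt0 A0.
have := entropy_gap (a ^ #|D|).-1 A0; rewrite -/L prednK //.
set q := a ^ #|D| in cY q0 L leXT *; move=> gap.
have qP : q ^ #|P| <= a ^ #|X| * q.-1 ^ #|P|.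
  have aT : 0 < a ^ #|T| by rewrite expn_gt0 A0.
  rewrite -(leq_pmul2l aT).
  apply: leq_trans (leq_mul cT (leqnn _)) _.
  by rewrite mulnAC; apply: leq_trans (leq_mul cY (leqnn _)) _; nia.
have cXV : #|~: X| = #|T| - #|X| by rewrite cardsCs setCK.
have leLP : #|X| * L <= #|P|.
  rewrite -(@leq_pmul2r (#|D| ^ 2)) ?expn_gt0 ?D0 //.
  by move: cP leXT; rewrite cXV; nia.
have P0 : 0 < #|P|.
  rewrite lt0n; apply/eqP => P0; move: cP leXT leLP; rewrite cXV P0; nia.
have lt1 : (a * q.-1 ^ L) ^ #|P| < (q ^ L) ^ #|P| by rewrite ltn_exp2r.
have le2 : (q ^ L) ^ #|P| <= (a ^ #|X| * q.-1 ^ #|P|) ^ L.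
  by rewrite -expnM mulnC expnM leq_exp2r.
have := leq_trans lt1 le2.
rewrite !expnMn -!expnM [L * _]mulnC ltn_mul2r => /andP[_].
by rewrite ltnNge leq_pexp2l.
Qed.

(** * Shifts, locality and decoding of NUCA *)

Lemma shiftK (G : groupType) (B : choiceType) (g : G) (x : config G B) :
  shift g^-1%g (shift g x) = x.
Proof. by apply: funext => h; rewrite /shift invgK mulKg. Qed.

Lemma shiftKV (G : groupType) (B : choiceType) (g : G) (x : config G B) :
  shift g (shift g^-1%g x) = x.
Proof. by rewrite -{1}(invgK g) shiftK. Qed.

Lemma nucaE (G : groupType) (A : finType) (M : {fset G})
    (s : config G (local_map A M)) (x : config G A) (g : G) :
  nuca s x g =
  (s g : {ffun {ffun M -> A} -> A}) [ffun m : M => x (g * val m)%g].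
Proof.
rewrite /nuca /restrict /shift; congr (_ _); apply/ffunP => m.
by rewrite !ffunE invgK.
Qed.

Lemma nuca_local (G : groupType) (A : finType) (M : {fset G})
    (s : config G (local_map A M)) (x y : config G A) (g : G) :
  (forall m, m \in M -> x (g * m)%g = y (g * m)%g) ->
  nuca s x g = nuca s y g.
Proof.
move=> exy; rewrite !nucaE; congr (_ _); apply/ffunP => m.
by rewrite !ffunE exy ?fsvalP.
Qed.

(** The shift acts on the field of local rules as well; only when [s] is
    constant does this make [nuca s] itself equivariant. *)
Lemma nuca_shift (G : groupType) (A : finType) (M : {fset G}) (g : G)
    (s : config G (local_map A M)) (x : config G A) :
  nuca (shift g s) (shift g x) = shift g (nuca s x).
Proof.
apply: funext => h; rewrite nucaE [RHS]nucaE; congr (_ _).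
by apply/ffunP => m; rewrite !ffunE /shift mulgA.
Qed.

(** If no window worked, pairs of configurations that differ at [g] but whose
    images agree on larger and larger windows would cluster at a pair that
    still differs at [g] and has equal images. *)
Lemma nuca_window (G : groupType) (A : finType) (M : {fset G})
    (p : config G (local_map A M)) (g : G) :
  injective (nuca p) ->
  exists W : {fset G}, forall x y,
    (forall h, h \in W -> nuca p x h = nuca p y h) -> x g = y g.
Proof.
move=> injp; apply: contrapT => noW.
have bad (W : {fset G}) : exists z : config G (A * A)%type,
    (forall h, h \in W -> nuca p (fst \o z) h = nuca p (snd \o z) h) /\
    (z g).1 <> (z g).2.
  apply: contrapT => nz; apply: noW; exists W => x y exy.
  by apply: contrapT => nxy; apply: nz; exists (fun h => (x h, y h)).
have {noW} [z zP] := choice bad.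
have [zz zzP] := config_cluster_point z.
have eqz : (fst \o zz : config G A) = (snd \o zz : config G A).
  apply: injp; apply: funext => h.
  have [W hW zW] := zzP [fset (h * m)%g | m in M] [fset h].
  have [+ _] := zP W; move=> /(_ h).
  rewrite (fsubsetP hW) ?inE // => /(_ isT) eqW.
  have loc (pr : A * A -> A) :
      nuca p (pr \o z W : config G A) h = nuca p (pr \o zz : config G A) h.
    by apply: nuca_local => m mM /=; rewrite zW //; apply/imfsetP; exists m.
  by rewrite -!loc.
have [W _ zW] := zzP [fset g] fset0.
have [_] := zP W; rewrite zW ?inE //; apply.
exact: (congr1 (fun x : config G A => x g) eqz).
Qed.

(** The window is translated to the identity, and left free to grow so that
    finitely many decoders can be given the same memory set.  Patterns that do
    not occur in an image are decoded arbitrarily. *)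
Lemma nuca_decoder (G : groupType) (A : finType) (M : {fset G})
    (p : config G (local_map A M)) (g : G) :
  injective (nuca p) ->
  exists W : {fset G}, forall N : {fset G}, 1%g \in N -> W `<=` N ->
    exists r : {ffun {ffun N -> A} -> A},
      forall x, r [ffun n : N => nuca p x (g * val n)%g] = x g.
Proof.
move=> /(nuca_window g)[W0 W0P].
exists [fset (g^-1 * h)%g | h in W0] => N N1 WN.
pose read x : {ffun N -> A} := [ffun n : N => nuca p x (g * val n)%g].
pose seen v := exists x, read x = v.
exists [ffun v : {ffun N -> A} =>
  if pselect (seen v) is left e then projT1 (cid e) g else v [` N1]].
move=> x; rewrite ffunE -/(read x); case: pselect => [e|[]]; last by exists x.
case: (cid e) => /= y exy; apply: W0P => h hW0.
have hN : (g^-1 * h)%g \in N by apply: (fsubsetP WN); apply/imfsetP; exists h.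
by move/ffunP: exy => /(_ [` hN]); rewrite !ffunE /= mulVKg.
Qed.

(** * Sofic approximations and direct finiteness *)

(** Soficity with one exceptional set [X] for all the conditions at once, and
    with an integral bound on its density.  Passing to [psi g = phi g^-1] turns
    the almost left action into an almost right action, so that
    [g |-> psi g i] is an approximate copy of [G] centred at [i], on which a
    memory set acts by right multiplication, as in [nucaE]. *)
Lemma sofic_right_action (R : realType) (G : groupType) :
  sofic R G -> forall (K : {fset G}) (C : nat),
  exists n : nat, (0 < n)%N /\
  exists (psi : G -> {perm 'I_n}) (X : {set 'I_n}),
    [/\ (#|X| * C <= n)%N,
        forall i g h, i \notin X -> g \in K -> h \in K ->
          psi (g * h)%g i = psi h (psi g i)
      & forall i g h, i \notin X -> g \in K -> h \in K ->
          psi g i = psi h i -> g = h].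
Proof.
move=> sof K C.
pose k := #|{: K * K}|; pose K' := [fset g^-1%g | g in K].
pose e : R := ((2 * k * C).+1%:R)^-1%R.
have e0 : (0 < e)%R by rewrite invr_gt0 ltr0n.
have [n [n0 [phi [hom sep]]]] := sof K' e e0.
have inK' g : g \in K -> g^-1%g \in K' by move=> gK; apply/imfsetP; exists g.
exists n; split=> //; exists (fun g => phi g^-1%g).
have nR : (0 < n%:R :> R)%R by rewrite ltr0n.
have small (S : {set 'I_n}) :
    (#|S|%:R / n%:R <= e)%R -> (#|S| * (2 * k * C).+1 <= n)%N.
  rewrite ler_pdivrMr // /e mulrC ler_pdivlMr ?ltr0n // -natrM ler_nat; lia.
pose Xm (u : K * K) := [set i |
  phi (val u.1 * val u.2)^-1%g i != phi (val u.2)^-1%g (phi (val u.1)^-1%g i)].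
pose Xe (u : K * K) := [set i | (u.1 != u.2) &&
  (phi (val u.1)^-1%g i == phi (val u.2)^-1%g i)].
have Xm_small u : (#|Xm u| * (2 * k * C).+1 <= n)%N.
  apply: small; have := hom _ _ (inK' _ (fsvalP u.2)) (inK' _ (fsvalP u.1)).
  rewrite /hamming; congr (_%:R / _ <= _)%R; apply: eq_card => i.
  by rewrite !inE invgM permM.
have Xe_small u : (#|Xe u| * (2 * k * C).+1 <= n)%N.
  apply: small; have [eq12|neq] := eqVneq u.1 u.2.
    by rewrite eq_card0 ?mul0r ?ltW // => i; rewrite !inE eq12 eqxx.
  have neq' : (val u.1)^-1%g <> (val u.2)^-1%g.
    by move=> /invg_inj /val_inj /eqP; apply/negP.
  have := sep _ _ (inK' _ (fsvalP u.1)) (inK' _ (fsvalP u.2)) neq'.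
  rewrite /hamming lerBlDl -lerBlDr; apply: le_trans.
  rewrite lerBrDr -mulrDl ler_pdivrMr // mul1r -natrD ler_nat.
  rewrite -[n in (_ <= n)%N]card_ord -(cardC (mem (Xe u))) leq_add2l.
  by apply/subset_leq_card/subsetP => i; rewrite !inE neq.
have bigcup_small (Y : K * K -> {set 'I_n}) :
    (forall u, #|Y u| * (2 * k * C).+1 <= n)%N ->
    (#|\bigcup_u Y u| * (2 * k * C).+1 <= k * n)%N.
  move=> Ysmall.
  apply: leq_trans (_ : (\sum_u #|Y u|) * (2 * k * C).+1 <= _)%N.
    rewrite leq_mul2r; apply/orP; right.
    elim/big_ind2: _ => [|a S b T leS leT|//]; first by rewrite cards0.
    by apply: leq_trans (leq_add leS leT); rewrite -cardsUI leq_addr.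
  rewrite big_distrl /= -sum_nat_const; exact: leq_sum.
exists (\bigcup_u Xm u :|: \bigcup_u Xe u); split.
- have := bigcup_small _ Xm_small; have := bigcup_small _ Xe_small.
  have [u _|noK] := pickP {: K * K}; last first.
    have -> : \bigcup_u Xm u = set0 by apply: big_pred0 => u; have := noK u.
    have -> : \bigcup_u Xe u = set0 by apply: big_pred0 => u; have := noK u.
    by rewrite setU0 cards0.
  have k0 : (0 < k)%N by apply/card_gt0P; exists u.
  have := cardsUI (\bigcup_u Xm u) (\bigcup_u Xe u).
  move: #|_ :|: _| #|_ :&: _| #|\bigcup_u Xm u| #|\bigcup_u Xe u|.
  move=> a b c d abcd le1 le2.
  have : (a * (2 * k * C).+1 <= 2 * k * n)%N.
    have : (a <= c + d)%N by lia.
    move: (2 * k * C).+1 le1 le2 => Z; nia.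
  have [->|C0] := posnP C; first by rewrite !muln0.
  move=> le; rewrite -(@leq_pmul2l (2 * k)) ?muln_gt0 ?k0 //; nia.
- move=> i g h; rewrite inE negb_or => /andP[iX _] gK hK.
  apply/eqP; apply: contraR iX => neq.
  by apply/bigcupP; exists ([` gK], [` hK]); rewrite ?inE.
- move=> i g h; rewrite inE negb_or => /andP[_ iX] gK hK egh.
  apply/eqP; apply: contraR iX => neq.
  by apply/bigcupP; exists ([` gK], [` hK]); rewrite ?inE //= egh eqxx andbT.
Qed.

(** Cellular automata over a sofic group are directly finite.  If the composite
    [sc \o sd] changes the letter of [y] at the identity, then no [sc u] can
    agree with [y] on the finite window [D] on which that letter depends, since
    [sc \o sd] fixes [sc u].  The map [f] induced by [c] on a sofic model would
    then contradict [defect_lower_bound], because the model looks like [G]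
    around all but very few of its points. *)
Lemma sofic_ca_directly_finite (R : realType) (G : groupType) (A : finType)
    (M N : {fset G}) (c : local_map A M) (d : local_map A N) :
  sofic R G ->
  cancel (nuca (fun=> c)) (nuca (fun=> d)) ->
  cancel (nuca (fun=> d)) (nuca (fun=> c)).
Proof.
set sc := nuca (fun=> c); set sd := nuca (fun=> d) => sof dc.
suff at1 y : sc (sd y) 1%g = y 1%g.
  move=> y; apply: funext => g.
  have := at1 (shift g^-1%g y).
  rewrite /sd /sc -[fun=> d]/(shift g^-1%g (fun=> d)) nuca_shift.
  rewrite -[fun=> c]/(shift g^-1%g (fun=> c)) nuca_shift.
  by rewrite /shift invgK mulg1.
apply: contrapT => neq.
pose D := 1%g |` [fset (m * n)%g | m in M, n in N].
have D1 : 1%g \in D by rewrite !inE eqxx.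
have forbidden u : exists d : D, sc u (val d) <> y (val d).
  apply: contrapT => allD; apply: neq.
  have agree g : g \in D -> sc u g = y g.
    by move=> gD; apply: contrapT => ng; apply: allD; exists [` gD].
  rewrite -(agree _ D1) -[in RHS](dc u).
  apply: nuca_local => m mM; apply: nuca_local => n nN.
  rewrite agree // mul1g; apply/fset1UP; right; exact: in_imfset2.
pose K := D `|` (M `|` N).
have DK g : g \in D -> g \in K by move=> gD; apply/fsetUP; left.
have MK g : g \in M -> g \in K.
  by move=> gM; apply/fsetUP; right; apply/fsetUP; left.
have NK g : g \in N -> g \in K.
  by move=> gN; apply/fsetUP; right; apply/fsetUP; right.
have [n [n0 [psi [X [small act inj]]]]] :=
  sofic_right_action sof K (defect_constant #|A| #|{: D}|).
pose f (x : {ffun 'I_n -> A}) : {ffun 'I_n -> A} :=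
  [ffun j => (c : {ffun {ffun M -> A} -> A}) [ffun m : M => x (psi (val m) j)]].
pose pull (x : {ffun 'I_n -> A}) i : config G A := fun g => x (psi g i).
have fE x i g : i \notin X -> g \in K -> f x (psi g i) = sc (pull x i) g.
  move=> iX gK; rewrite /sc nucaE ffunE; congr (_ _); apply/ffunP => m.
  by rewrite !ffunE /pull act // MK ?fsvalP.
have psi1 i : i \notin X -> psi 1%g i = i.
  by move=> iX; apply: (@perm_inj _ (psi 1%g)); rewrite -act ?DK ?mulg1.
suff : (#|'I_n| < #|X| * defect_constant #|A| #|{: D}|)%N.
  by rewrite card_ord ltnNge small.
apply: (@defect_lower_bound _ _ _
  (fun d : D => psi (val d)) (fun d => y (val d)) f).
- by rewrite card_ord.
- by apply/card_gt0P; exists [` D1].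
- move=> i iX d1 d2 /inj e; apply: val_inj.
  by apply: e => //; rewrite DK ?fsvalP.
- move=> x x' efx i iX.
  have : sd (sc (pull x i)) 1%g = sd (sc (pull x' i)) 1%g.
    by apply: nuca_local => m mN; rewrite mul1g -!fE ?efx ?NK.
  by rewrite !dc /pull psi1.
- move=> x i iX; have [d0 nd] := forbidden (pull x i).
  by exists d0; rewrite fE // DK ?fsvalP.
Qed.

(** * Orbit closures of asymptotically constant configurations *)

Lemma shift_orbit_closure (G : groupType) (B : choiceType) (x : config G B)
    (g : G) :
  orbit_closure x (shift g x).
Proof. by apply: subset_closure; exists g. Qed.

Lemma orbit_closure_finite (G : groupType) (B : choiceType) (x p : config G B)
    (U : {fset G}) :
  (forall g, g \in U) -> orbit_closure x p -> exists g, p = shift g x.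
Proof.
move=> allU /closure_configP/(_ U)[_ [g _ <-] agree].
by exists g; apply: funext => h; rewrite agree.
Qed.

(** If [p] has a letter other than [b] at [h], then a translate [shift g x]
    agreeing with [p] at [h] must have [g^-1 * h] in the exceptional set, so
    only finitely many translates can approach [p], and one equals [p]. *)
Lemma orbit_closure_asymptotic (G : groupType) (B : choiceType)
    (x p : config G B) (b : B) :
  asymptotic x (fun=> b) -> orbit_closure x p ->
  (exists g, p = shift g x) \/ p = (fun=> b).
Proof.
move=> [E xE] /closure_configP clp.
have [->|] := pselect (p = (fun=> b)); first by right.
move=> pb; left; apply: contrapT => norb.
have [h ph] : exists h, p h <> b.
  apply: contrapT => nh; apply: pb; apply: funext => h.
  by apply: contrapT => ?; apply: nh; exists h.
have /choice[k kP] g : exists k, p k <> shift g x k.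
  apply: contrapT => nk; apply: norb; exists g; apply: funext => k.
  by apply: contrapT => ?; apply: nk; exists k.
have [_ [g _ <-] agree] := clp (h |` [fset k (h * e^-1)%g | e in E]).
have gE : (g^-1 * h)%g \in E.
  apply/negPn/negP => /xE; rewrite -/(shift g x h) agree //.
  exact: fset1U1.
apply: (kP g); rewrite agree //; apply/fset1UP; right.
by apply/imfsetP; exists (g^-1 * h)%g; rewrite // invMg invgK mulVKg.
Qed.

(** Translations move the exceptional set of [x] off any finite window. *)
Lemma orbit_closure_constant (G : groupType) (B : choiceType) (x : config G B)
    (b : B) :
  (forall K : {fset G}, exists g, g \notin K) ->
  asymptotic x (fun=> b) -> orbit_closure x (fun=> b).
Proof.
move=> infG [E xE]; apply/closure_configP => K.
have [g gKE] := infG [fset (k * e^-1)%g | k in K, e in E].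
exists (shift g x) => [|k kK]; first by exists g.
apply: xE; apply: contra gKE => eE; apply/imfset2P.
by exists k => //; exists (g^-1 * k)%g; rewrite // invMg invgK mulVKg.
Qed.

(** * Inverses of NUCA *)

(** Once the letters off [F] are those of [y], [tau] permutes the finitely many
    fillings of [F]. *)
Lemma finite_perturbation_surj (G : groupType) (A : finType) (F : {fset G})
    (tau : config G A -> config G A) :
  injective tau -> (forall x g, g \notin F -> tau x g = x g) ->
  forall y, exists x, tau x = y.
Proof.
move=> inj out y.
pose ext (v : {ffun F -> A}) : config G A :=
  fun g => if insub g is Some f then v f else y g.
have extF v (f : F) : ext v (val f) = v f by rewrite /ext valK.
have extN v g : g \notin F -> ext v g = y g by move=> gF; rewrite /ext insubN.
pose T (v : {ffun F -> A}) := [ffun f : F => tau (ext v) (val f)].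
have injT : injective T.
  move=> v w eT; suff : ext v = ext w.
    by move=> e; apply/ffunP => f; rewrite -!extF e.
  apply: inj; apply: funext => g; have [gF|gF] := boolP (g \in F).
    by move/ffunP: eT => /(_ [` gF]); rewrite !ffunE.
  by rewrite !out // !extN.
exists (ext (invF injT [ffun f : F => y (val f)])).
apply: funext => g; have [gF|gF] := boolP (g \in F).
  have := f_invF injT [ffun f : F => y (val f)].
  by move/ffunP => /(_ [` gF]); rewrite !ffunE.
by rewrite out // extN.
Qed.

Lemma nuca_decoders (G : groupType) (A : finType) (M : {fset G})
    (p : config G (local_map A M)) (F N0 : {fset G}) :
  injective (nuca p) ->
  exists N : {fset G}, [/\ 1%g \in N, N0 `<=` N &
    exists t : config G (local_map A N),
      forall g x, g \in F -> nuca t (nuca p x) g = x g].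
Proof.
move=> injp; have [W WP] := choice (fun g => nuca_decoder g injp).
pose N := 1%g |` (N0 `|` \bigcup_(g <- F) W g).
have N1 : 1%g \in N by rewrite !inE eqxx.
exists N; split=> //.
  by apply/fsubsetP => h hN; rewrite !inE hN orbT.
have rP g : exists r : local_map A N, g \in F ->
    forall x, (r : {ffun {ffun N -> A} -> A})
      [ffun n : N => nuca p x (g * val n)%g] = x g.
  have [gF|] := boolP (g \in F); last first.
    by exists [ffun v : {ffun N -> A} => v [` N1]].
  have [|r rP] := WP g N N1; last by exists r.
  apply/fsubsetP => h hW; rewrite !inE; apply/orP; right; apply/orP; right.
  by apply/bigfcupP; exists g; rewrite ?gF.
have [t tP] := choice rP.
by exists t => g x gF; rewrite nucaE tP.
Qed.

(** A left inverse of a surjection is two-sided, and conjugating by the shift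
    translates both fields of rules. *)
Lemma nuca_inverse_shift (G : groupType) (A : finType) (M N : {fset G})
    (s : config G (local_map A M)) (t : config G (local_map A N)) :
  cancel (nuca s) (nuca t) -> (forall y, exists x, nuca s x = y) ->
  forall g, nuca (shift g s) \o nuca (shift g t) = id /\
            nuca (shift g t) \o nuca (shift g s) = id.
Proof.
move=> ts surj g.
have st : cancel (nuca t) (nuca s).
  by move=> y; have [x <-] := surj y; rewrite ts.
split; apply: funext => x /=; rewrite -[x in LHS](shiftKV g) !nuca_shift.
  by rewrite st shiftKV.
by rewrite ts shiftKV.
Qed.

Theorem theoremA (R : realType) (G : groupType) (A : finType) (M : {fset G})
    (s : config G (local_map A M)) :
  finitely_generated G -> sofic R G ->
  asymptotically_constant s -> stably_injective s ->
  stably_invertible s.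
Proof.
move=> _ sof [c [E sE]] stab.
have injs : injective (nuca s).
  apply: stab; have {2}-> : s = shift 1%g s; last exact: shift_orbit_closure.
  by apply: funext => h; rewrite /shift invg1 mul1g.
have [infG|] := pselect (forall K : {fset G}, exists g, g \notin K); last first.
  move=> finG; have [U allU] : exists U : {fset G}, forall g, g \in U.
    apply: contrapT => noU; apply: finG => K; apply: contrapT => allK.
    by apply: noU; exists K => g; apply/negPn/negP => gK; apply: allK; exists g.
  have [N [_ _ [t tP]]] := nuca_decoders U fset0 injs.
  exists N, t => p /(orbit_closure_finite allU)[g ->].
  exists (shift g t); split; first exact: shift_orbit_closure.
  apply: nuca_inverse_shift.
    by move=> x; apply: funext => h; rewrite tP.
  by apply: (@finite_perturbation_surj _ _ U) => // x h; rewrite allU.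
have injc : injective (nuca (fun=> c)).
  by apply: stab; apply: orbit_closure_constant => //; exists E.
(* The decoder of the constant rule at the identity works at every point. *)
have [W decoder] : exists W : {fset G}, forall N : {fset G},
    1%g \in N -> W `<=` N ->
    exists d : local_map A N, cancel (nuca (fun=> c)) (nuca (fun=> d)).
  have [W WP] := nuca_decoder 1%g injc.
  exists W => N N1 WN; have [d dP] := WP N N1 WN.
  exists d => x; apply: funext => g.
  have := dP (shift g^-1%g x).
  rewrite -[fun=> c]/(shift g^-1%g (fun=> c)) nuca_shift.
  rewrite /shift invgK mulg1 => <-.
  by rewrite nucaE; congr (_ _); apply/ffunP => m; rewrite !ffunE mul1g.
have [d0 d0c] := decoder _ (fset1U1 1%g W) (fsubsetU1 1%g W).
have cd0 := sofic_ca_directly_finite sof d0c.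
(* Off [F], the window of [d0] does not meet [E], where [s] and [c] differ. *)
pose F := [fset (e * n^-1)%g | e in E, n in 1%g |` W].
have far x g : g \notin F -> nuca (fun=> d0) (nuca s x) g = x g.
  move=> gF; rewrite -[in RHS](d0c x); apply: nuca_local => n nN.
  rewrite [LHS]nucaE [RHS]nucaE sE //; apply: contra gF => gnE.
  by apply/imfset2P; exists (g * n)%g => //; exists n; rewrite // mulgK.
have surj y : exists x, nuca s x = y.
  have [|x xP] := @finite_perturbation_surj _ _ F _ _ far (nuca (fun=> d0) y).
    exact: inj_comp (can_inj cd0) injs.
  by exists x; apply: (can_inj cd0).
(* [F] depends on the memory set of [d0], and the decoders on [F] need a larger
   memory set [N]; the constant rule is decoded anew, by some [d] over [N],
   which by uniqueness of inverses defines the same map as [d0]. *)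
have [N [N1 WN [t0 t0P]]] := nuca_decoders F W injs.
have [d dc] := decoder N N1 WN.
pose t : config G (local_map A N) := fun g => if g \in F then t0 g else d.
have ts : cancel (nuca s) (nuca t).
  move=> x; apply: funext => g; have [gF|gF] := boolP (g \in F).
    by rewrite nucaE /t gF -nucaE t0P.
  rewrite nucaE /t (negbTE gF) -(nucaE (fun=> d)) -(far x g gF).
  by rewrite -[in LHS](cd0 (nuca s x)) dc.
have sE' : asymptotic s (fun=> c) by exists E.
exists N, t => p clp; have [[g ->]|->] := orbit_closure_asymptotic sE' clp.
- exists (shift g t); split; first exact: shift_orbit_closure.
  exact: nuca_inverse_shift.
- exists (fun=> d); split.
    apply: orbit_closure_constant => //.
    by exists F => g gF; rewrite /t (negbTE gF).
  split; apply: funext => x /=; last exact: dc.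
  exact: (sofic_ca_directly_finite sof dc).
Qed.
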